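(* Let $(Y,d)$ be a complete and separable metric space. Then the completion of the metric space $(M_{\mathrm{loc}}(Y),MH)$ is $(Q(Y),MH)$.
   Context: $Q(Y)$ is the collection of all Borel probability measures on $Y$, and $M_{\mathrm{loc}}(Y)\subseteq Q(Y)$ is the collection of those that have bounded support, where the support of a Borel measure $\nu$ is $\mathrm{supp}(\nu)=Y\setminus\bigcup\{A\subseteq Y: A \text{ open},\ \nu(A)=0\}$. Let $\mathrm{Lip}_1(Y)=\{f:Y\to\mathbb{R} : |f(x)-f(y)|\le d(x,y)\text{ for all }x,y\in Y\}$. The modified Kantorovich metric $MH$ on $Q(Y)$ (and, by restriction, on $M_{\mathrm{loc}}(Y)$) is $$MH(\mu,\nu)=\sup\left\{\left|\int_Y f\,d\mu-\int_Y f\,d\nu\right| : f\in\mathrm{Lip}_1(Y)\text{ and }\|f\|_\infty\le 1\right\}.$$ That $(Q(Y),MH)$ is the completion of $(M_{\mathrm{loc}}(Y),MH)$ means that $(Q(Y),MH)$ is a complete metric space and $M_{\mathrm{loc}}(Y)$ is dense in it. *)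

(* Defs.v *)
From HB Require Import structures.
From mathcomp Require Import all_boot all_order all_algebra.
From mathcomp Require Import all_classical all_reals all_analysis.

Set Implicit Arguments.
Unset Strict Implicit.
Unset Printing Implicit Defensive.

Import Order.TTheory GRing.Theory Num.Theory.
Import numFieldTopology.Exports.

Local Open Scope classical_set_scope.
Local Open Scope ring_scope.

#[short(type="completeMetricType")]
HB.structure Definition CompleteMetric (R : numDomainType) :=
  { T of Metric R T & CompletePseudoMetric R T }.

Definition separable (T : topologicalType) : Prop :=
  exists2 D : set T, countable D & dense D.

Section metric_up_to.
Context {R : realType} {T : Type}.
Variables (eqv : T -> T -> Prop) (dist : T -> T -> R).

(* [dist] is a metric on [T] modulo the identification [eqv] *)
Definition is_metric : Prop :=
  [/\ forall x y, 0 <= dist x y,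
      forall x y, dist x y = 0 <-> eqv x y,
      forall x y, dist x y = dist y x &
      forall x y z, dist x z <= dist x y + dist y z].

Definition metric_complete : Prop :=
  forall u : nat -> T,
    (forall e : R, 0 < e -> \forall m & n \near \oo, dist (u m) (u n) < e) ->
    exists x : T, dist (u n) x @[n --> \oo] --> (0 : R).

Definition metric_dense (A : set T) : Prop :=
  forall (x : T) (e : R), 0 < e -> exists2 y, A y & dist x y < e.

Definition is_completion_of (A : set T) : Prop :=
  [/\ is_metric, metric_complete & metric_dense A].

End metric_up_to.

Section borel_probability_measures.
Context {R : realType} (Y : completeMetricType R).

Definition borel : measurableType _ := g_sigma_algebraType (@open Y).

Definition borel_probability := probability borel R.

(* A measure is a function on all of [set Y], unconstrained outside the
   measurable sets, so equality of Borel measures is not Leibniz equality. *)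
Definition eq_borel (mu nu : borel_probability) : Prop :=
  forall A : set borel, measurable A -> mu A = nu A.

Definition supp (nu : borel_probability) : set Y :=
  ~` \bigcup_(A in [set A : set Y | open A /\ nu A = 0%E]) A.

Definition metric_bounded (A : set Y) : Prop :=
  exists M : R, forall x y, A x -> A y -> mdist x y <= M.

Definition Mloc : set borel_probability :=
  [set nu | metric_bounded (supp nu)].

Definition Lip1 : set (Y -> R) :=
  [set f | forall x y, `|f x - f y| <= mdist x y].

(* The set below contains 0 and is bounded above by 2, so the real-valued
   [sup] is its least upper bound. *)
Definition MH (mu nu : borel_probability) : R :=
  sup [set `| \int[mu]_(x in [set: borel]) f x
              - \int[nu]_(x in [set: borel]) f x |
      | f in [set f : Y -> R | Lip1 f /\ forall x, `|f x| <= 1]].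

End borel_probability_measures.

(* Main.v *)
Require Import Defs.
From HB Require Import structures.
From mathcomp Require Import all_boot all_order all_algebra.
From mathcomp Require Import all_classical all_reals all_analysis.
From mathcomp Require Import measurable_realfun ring lra.

(** The metric axioms and the density of the boundedly supported measures are
elementary. If all integrals of bounded Lipschitz functions against [mu] and
[nu] agree, then so do the values on every open set [U], because the functions
[min(1, n d(x, ~U))] increase to the indicator of [U]; opens generate the Borel
sets and are stable under intersection, so [mu] and [nu] are equal. For density,
all the mass lying outside a large ball is moved to its centre: this changes the
integral of a test function by at most twice that mass.

Completeness is the substance. Let [u] be Cauchy. Integrals of a bounded
Lipschitz function [f] against [u n] form a Cauchy sequence of reals, whose limit
[L f] defines a positive linear functional with [L 1 = 1], and the convergence is
uniform over the test functions of the metric. So it suffices to find a Borel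
probability measure that represents [L]; the proof does this without weak
compactness, by a Daniell extension ([daniell_representation]). For a set [A],
take the infimum of [sum_k L(f_k)] over the sequences of nonnegative bounded
Lipschitz functions with [sum_k f_k >= 1] on [A]. This is an outer measure, and
multiplying a cover by [min(1, n d(x, ~U))] and by its complement to 1 shows that
open sets are Caratheodory measurable ([open_bl_outer_caratheodory]). Cutting a
function into thin horizontal layers bounds its integral by its value under [L],
and the opposite bound follows by applying the first one to [1 - f].

The extension loses no mass exactly when [sum_k f_k >= 1] everywhere implies
[sum_k L(f_k) >= 1] ([cauchy_lim_sigma]). This is where separability and
completeness enter, through uniform tightness ([cauchy_tight]): on a compact set
carrying almost all the mass of every [u n], finitely many of the [f_k] already
sum to almost 1. Tightness is extracted from the metric itself: for a dense
sequence [c], the truncated distance to [c_0, ..., c_(J-1)] is a test function,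
so its integral is small for all [n] as soon as it is small for finitely many
[n], and each such integral tends to 0 with [J]. *)

Set Implicit Arguments.
Unset Strict Implicit.
Unset Printing Implicit Defensive.

Import Order.TTheory GRing.Theory Num.Theory.
Import numFieldTopology.Exports numFieldNormedType.Exports.

Local Open Scope classical_set_scope.
Local Open Scope ring_scope.

(** * Bounded Lipschitz functions and their integrals *)

Section bounded_lipschitz.
Context {R : realType} {Y : completeMetricType R}.
Implicit Types (f g : Y -> R) (K : R) (mu nu : borel_probability Y).

(** A single constant bounds both the function and its Lipschitz ratio, so that,
when it is positive, dividing by it produces a test function of [MH]. *)
Definition bounded_lipschitz f := exists2 K, 0 <= K &
  (forall x y, `|f x - f y| <= K * mdist x y) /\ (forall x, `|f x| <= K).

Lemma bl_cst (c : R) : bounded_lipschitz (fun=> c).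
Proof.
exists `|c| => //; split => // x y; rewrite subrr normr0.
by rewrite mulr_ge0// mdist_ge0.
Qed.

Lemma blD f g : bounded_lipschitz f -> bounded_lipschitz g ->
  bounded_lipschitz (fun x => f x + g x).
Proof.
move=> [K K0 [fL fK]] [M M0 [gL gM]]; exists (K + M); first exact: addr_ge0.
split => [x y|x].
- by rewrite opprD addrACA (le_trans (ler_normD _ _))// mulrDl lerD.
- by rewrite (le_trans (ler_normD _ _))// lerD.
Qed.

Lemma blM f g : bounded_lipschitz f -> bounded_lipschitz g ->
  bounded_lipschitz (fun x => f x * g x).
Proof.
move=> [K K0 [fL fK]] [M M0 [gL gM]]; have KM := mulr_ge0 K0 M0.
exists (2 * (K * M)); first exact: mulr_ge0.
split => [x y|x].
- have -> : f x * g x - f y * g y = f x * (g x - g y) + (f x - f y) * g y.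
    by ring.
  rewrite (le_trans (ler_normD _ _))// !normrM.
  have -> : 2 * (K * M) * mdist x y =
      K * (M * mdist x y) + K * mdist x y * M by ring.
  by rewrite lerD// ler_pM.
- by rewrite normrM mulr_natl mulr2n (le_trans (ler_pM _ _ (fK x) (gM x)))// lerDl.
Qed.

Lemma blB f g : bounded_lipschitz f -> bounded_lipschitz g ->
  bounded_lipschitz (fun x => f x - g x).
Proof.
move=> fB gB; under eq_fun do rewrite -mulN1r.
by apply: blD => //; apply: blM => //; exact: bl_cst.
Qed.

Lemma bl_sum (I : Type) (r : seq I) (f : I -> Y -> R) :
  (forall i, bounded_lipschitz (f i)) ->
  bounded_lipschitz (fun x => \sum_(i <- r) f i x).
Proof.
move=> fB; elim: r => [|i r IH].
  by under eq_fun do rewrite big_nil; exact: bl_cst.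
by under eq_fun do rewrite big_cons; exact: blD.
Qed.

Lemma ler_dist_max (a b c d : R) :
  `|Num.max a b - Num.max c d| <= Num.max `|a - c| `|b - d|.
Proof.
rewrite ler_norml; apply/andP.
have := ler_norm (a - c); have := ler_norm (c - a).
have := ler_norm (b - d); have := ler_norm (d - b).
rewrite (distrC c a) (distrC d b).
move: `|a - c| `|b - d| => u v.
by rewrite /Num.max; do 3 case: ifPn; rewrite -?leNgt => *; split; lra.
Qed.

Lemma bl_max f g : bounded_lipschitz f -> bounded_lipschitz g ->
  bounded_lipschitz (fun x => Num.max (f x) (g x)).
Proof.
move=> [K K0 [fL fK]] [M M0 [gL gM]]; exists (K + M); first exact: addr_ge0.
split => [x y|x].
- rewrite (le_trans (ler_dist_max _ _ _ _))// ge_max.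
  apply/andP; split.
    by rewrite (le_trans (fL x y))// ler_wpM2r ?mdist_ge0// lerDl.
  by rewrite (le_trans (gL x y))// ler_wpM2r ?mdist_ge0// lerDr.
- rewrite /Num.max; case: ifPn => _.
    by rewrite (le_trans (gM x))// lerDr.
  by rewrite (le_trans (fK x))// lerDl.
Qed.

Lemma bl_min f g : bounded_lipschitz f -> bounded_lipschitz g ->
  bounded_lipschitz (fun x => Num.min (f x) (g x)).
Proof.
move=> fB gB.
rewrite (_ : (fun x => _) = fun x => f x + g x - Num.max (f x) (g x)).
  by apply: blB; [exact: blD|exact: bl_max].
by apply/funext => x; rewrite -(addr_max_min (f x)) addrC addKr.
Qed.

Lemma bl_lip1 f : Lip1 f -> (forall x, `|f x| <= 1) -> bounded_lipschitz f.
Proof. by move=> f1 fb; exists 1 => //; split => // x y; rewrite mul1r. Qed.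

Lemma bl_continuous f : bounded_lipschitz f -> continuous f.
Proof.
move=> [K K0 [fL _]] x; apply/cvgrPdist_lt => e e0.
have K1 : 0 < K + 1 by rewrite ltr_pwDr.
apply/nbhs_ballP; exists (e / (K + 1)) => /=; first exact: divr_gt0.
move=> y; rewrite ballEmdist/= => xy.
rewrite (le_lt_trans (fL x y))// (@le_lt_trans _ _ ((K + 1) * mdist x y))//.
  by rewrite ler_wpM2r ?mdist_ge0// lerDl.
by rewrite mulrC -ltr_pdivlMr.
Qed.

Lemma open_borel (U : set (borel Y)) : open (U : set Y) -> measurable U.
Proof. by move=> oU; apply: sub_sigma_algebra. Qed.

Lemma closed_borel (U : set (borel Y)) : closed (U : set Y) -> measurable U.
Proof.
move=> cU; rewrite -(setCK U); apply: measurableC; apply: open_borel.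
exact: closed_openC.
Qed.

Lemma bl_measurable f : bounded_lipschitz f ->
  measurable_fun [set: borel Y] (f : borel Y -> R).
Proof.
move=> /bl_continuous/continuousP cf.
apply: (measurability _ (RGenOpens.measurableE R)) => //.
move=> _ [_ [a [b ->] <-]].
by rewrite setTI; apply: open_borel; exact: cf (interval_open _ _).
Qed.

Lemma bl_integrable mu f : bounded_lipschitz f ->
  mu.-integrable setT (EFin \o f).
Proof.
move=> fB; apply: measurable_bounded_integrable => //.
- by rewrite [X in (X < _)%E](probability_setT mu) ltry.
- exact: bl_measurable.
- have [K K0 [_ fK]] := fB.
  exists K; split; first exact: num_real.
  by move=> M KM x _; exact: le_trans (fK x) (ltW KM).
Qed.

Lemma Rintegral_cst1 mu (c : R) : \int[mu]_(x in [set: borel Y]) c = c.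
Proof. by rewrite Rintegral_cst// [X in fine X](probability_setT mu) mulr1. Qed.

Lemma indic_integrable mu (A : set (borel Y)) (c : R) : measurable A ->
  mu.-integrable setT (EFin \o (fun x => c * \1_A x)).
Proof.
move=> mA; apply: (integrableZl measurableT c (f := EFin \o \1_A)).
apply: measurable_bounded_integrable => //.
  by rewrite [X in (X < _)%E](probability_setT mu) ltry.
exists 1; split; first exact: num_real.
move=> M M1 x _; apply: le_trans (ltW M1).
by rewrite indicE; case: (_ \in _); rewrite ?normr1 ?normr0.
Qed.

Lemma Rintegral_indic mu (A : set (borel Y)) (c : R) : measurable A ->
  \int[mu]_(x in [set: borel Y]) (c * \1_A x) = c * fine (mu A).
Proof.
move=> mA; rewrite RintegralZl//; last first.
  by have := indic_integrable mu 1 mA; under eq_fun do rewrite /= mul1r.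
by rewrite /Rintegral integral_indic// setIT.
Qed.

Lemma Rintegral_le_measure mu (A : set (borel Y)) (c : R) f :
  measurable A -> bounded_lipschitz f -> (forall x, f x <= c * \1_A x) ->
  \int[mu]_(x in [set: borel Y]) f x <= c * fine (mu A).
Proof.
move=> mA fB fA; rewrite -Rintegral_indic//; apply: le_Rintegral => //.
  exact: bl_integrable.
exact: indic_integrable.
Qed.

Lemma measure_le_Rintegral mu (A : set (borel Y)) (c : R) f :
  measurable A -> bounded_lipschitz f -> (forall x, c * \1_A x <= f x) ->
  c * fine (mu A) <= \int[mu]_(x in [set: borel Y]) f x.
Proof.
move=> mA fB fA; rewrite -Rintegral_indic//; apply: le_Rintegral => //.
  exact: indic_integrable.
exact: bl_integrable.
Qed.

Lemma ler_norm_Rintegral mu f (c : R) : bounded_lipschitz f ->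
  (forall x, `|f x| <= c) -> `|\int[mu]_(x in [set: borel Y]) f x| <= c.
Proof.
move=> fB fc; rewrite (le_trans (le_normr_Rintegral _ _))//.
  exact: bl_integrable.
rewrite -[leRHS](Rintegral_cst1 mu) le_Rintegral//.
  have := bl_integrable mu fB; move/integrable_norm.
  by [].
exact: (bl_integrable mu (bl_cst c)).
Qed.

Lemma MH_ub mu nu : has_ubound
  [set `| \int[mu]_(x in [set: borel Y]) f x
              - \int[nu]_(x in [set: borel Y]) f x |
      | f in [set f : Y -> R | Lip1 f /\ forall x, `|f x| <= 1]].
Proof.
exists 2 => _ [f [f1 fb] <-].
rewrite (le_trans (ler_normB _ _))//.
have fB := bl_lip1 f1 fb.
by rewrite (_ : 2 = 1 + 1)// lerD// ler_norm_Rintegral.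
Qed.

Lemma le_MH mu nu f : Lip1 f -> (forall x, `|f x| <= 1) ->
  `| \int[mu]_(x in [set: borel Y]) f x
     - \int[nu]_(x in [set: borel Y]) f x | <= MH mu nu.
Proof. by move=> f1 fb; apply: ub_le_sup; [exact: MH_ub|exists f]. Qed.

Lemma MH_le mu nu c :
  (forall f, Lip1 f -> (forall x, `|f x| <= 1) ->
    `| \int[mu]_(x in [set: borel Y]) f x
       - \int[nu]_(x in [set: borel Y]) f x | <= c) -> MH mu nu <= c.
Proof.
move=> H; apply: ge_sup; last by move=> _ [f [f1 fb] <-]; exact: H.
exists 0, (fun=> 0); last by rewrite !Rintegral_cst1 subrr normr0.
by split => [x y|x]; rewrite ?subrr normr0 ?mdist_ge0.
Qed.

Lemma MH_ge0 mu nu : 0 <= MH mu nu.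
Proof.
apply: le_trans (@le_MH mu nu (fun=> 0) _ _) => //.
  by move=> x y; rewrite subrr normr0 mdist_ge0.
by move=> x; rewrite normr0.
Qed.

Lemma MHC mu nu : MH mu nu = MH nu mu.
Proof.
by apply/eqP; rewrite eq_le; apply/andP; split; apply: MH_le => f f1 fb;
  rewrite distrC; exact: le_MH.
Qed.

Lemma MH_triangle mu nu rho : MH mu rho <= MH mu nu + MH nu rho.
Proof.
apply: MH_le => f f1 fb; set a := Rintegral _ _ _; set c := Rintegral rho _ _.
set b := \int[nu]_(x in [set: borel Y]) f x.
by rewrite (le_trans (ler_distD b _ _))// lerD// le_MH.
Qed.

(** Convergence in [MH] controls every bounded Lipschitz function, by rescaling
to a test function. *)
Lemma le_bl_MH mu nu f K : 0 < K ->
  (forall x y, `|f x - f y| <= K * mdist x y) -> (forall x, `|f x| <= K) ->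
  `| \int[mu]_(x in [set: borel Y]) f x
     - \int[nu]_(x in [set: borel Y]) f x | <= K * MH mu nu.
Proof.
move=> K0 fL fK.
have fB : bounded_lipschitz f by exists K => //; exact: ltW.
have H := @le_MH mu nu (fun x => K^-1 * f x).
have := H; rewrite !RintegralZl//; try exact: bl_integrable.
rewrite -mulrBr normrM gtr0_norm ?invr_gt0// mulrC ler_pdivrMr// mulrC; apply.
- move=> x y; rewrite -mulrBr normrM gtr0_norm ?invr_gt0//.
  by rewrite mulrC ler_pdivrMr// mulrC.
- move=> x; rewrite normrM gtr0_norm ?invr_gt0//.
  by rewrite mulrC ler_pdivrMr// mul1r.
Qed.

Lemma eq_MH0 mu nu : eq_borel mu nu -> MH mu nu = 0.
Proof.
move=> E; apply/eqP; rewrite eq_le MH_ge0 andbT; apply: MH_le => f f1 fb.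
rewrite /Rintegral (@eq_measure_integral _ _ _ _ nu) ?subrr ?normr0//.
by move=> A mA _; exact: E.
Qed.

End bounded_lipschitz.

(** * Urysohn functions and separation of measures *)

Section urysohn_functions.
Context {R : realType} {Y : completeMetricType R}.
Implicit Types (A U : set Y) (x y : Y).

(** The value 1 is thrown in so that the infimum also has the intended value 1
when [A] is empty, that is, for the complement of the whole space. *)
Definition truncated_dist A x : R :=
  inf ([set 1] `|` [set mdist x a | a in A]).

Let values A x := [set 1 : R] `|` [set mdist x a | a in A].

Let values_lb A x : lbound (values A x) 0.
Proof. by move=> _ [->|[a _ <-]]; rewrite ?mdist_ge0. Qed.

Let values_neq0 A x : values A x !=set0. Proof. by exists 1; left. Qed.

Lemma truncated_dist_ge0 A x : 0 <= truncated_dist A x.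
Proof. by apply: lb_le_inf; [exact: values_neq0|exact: values_lb]. Qed.

Lemma truncated_dist_le1 A x : truncated_dist A x <= 1.
Proof. by apply: ge_inf; [exists 0; exact: values_lb|left]. Qed.

Lemma truncated_dist_le A x a : A a -> truncated_dist A x <= mdist x a.
Proof.
by move=> Aa; apply: ge_inf; [exists 0; exact: values_lb|right; exists a].
Qed.

Lemma truncated_dist_eq0 A x : A x -> truncated_dist A x = 0.
Proof.
move=> Ax; apply/eqP; rewrite eq_le truncated_dist_ge0 andbT.
by rewrite -(mdistxx x); exact: truncated_dist_le.
Qed.

(** Closedness is what separates a point from [A]: a ball around it misses [A]. *)
Lemma truncated_dist_gt0 A x : closed A -> ~ A x -> 0 < truncated_dist A x.
Proof.
move=> /closed_openC oA Ax.
have /nbhs_ballP[e /= e0 xeA] := open_nbhs_nbhs (conj oA Ax).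
apply: (@lt_le_trans _ _ (Num.min 1 e)); first by rewrite lt_min ltr01.
apply: lb_le_inf => [|_ [->|[a Aa <-]]];
  [exact: values_neq0|by rewrite ge_min lexx|].
rewrite ge_min; apply/orP; right; rewrite leNgt; apply/negP => xae.
by apply: (xeA a) => //; rewrite ballEmdist.
Qed.

Lemma truncated_dist_lip1 A : Lip1 (truncated_dist A).
Proof.
have H x y : truncated_dist A x - truncated_dist A y <= mdist x y.
  rewrite lerBlDl -lerBlDr; apply: lb_le_inf => [|_ [->|[a Aa <-]]].
  - exact: values_neq0.
  - rewrite lerBlDr (le_trans (truncated_dist_le1 _ _))//.
    by rewrite lerDl mdist_ge0.
  - rewrite lerBlDl (le_trans _ (metric_triangle _ y _))//.
    exact: truncated_dist_le.
move=> x y; rewrite ler_norml H andbT lerNl opprB.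
by rewrite (le_trans (H y x))// metric_sym.
Qed.

Lemma truncated_dist_bl A : bounded_lipschitz (truncated_dist A).
Proof.
apply: bl_lip1; first exact: truncated_dist_lip1.
by move=> x; rewrite ger0_norm ?truncated_dist_ge0// truncated_dist_le1.
Qed.

Definition urysohn U (n : nat) x : R :=
  Num.min 1 (n%:R * truncated_dist (~` U) x).

Lemma urysohn_bl U n : bounded_lipschitz (urysohn U n).
Proof.
apply: bl_min; first exact: bl_cst.
by apply: blM; [exact: bl_cst|exact: truncated_dist_bl].
Qed.

Lemma urysohn_ge0 U n x : 0 <= urysohn U n x.
Proof. by rewrite le_min ler01 mulr_ge0// truncated_dist_ge0. Qed.

Lemma urysohn_le1 U n x : urysohn U n x <= 1.
Proof. by rewrite ge_min lexx. Qed.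

Lemma urysohn0 U x : urysohn U 0 x = 0.
Proof. by rewrite /urysohn mul0r min_r. Qed.

Lemma urysohn_out U n x : ~ U x -> urysohn U n x = 0.
Proof. by move=> Ux; rewrite /urysohn truncated_dist_eq0// mulr0 min_r. Qed.

Lemma urysohn_nondecreasing U x : nondecreasing_seq (urysohn U ^~ x).
Proof.
move=> m n mn; rewrite /urysohn le_min ge_min lexx/= ge_min.
by rewrite ler_wpM2r ?orbT ?truncated_dist_ge0// ler_nat.
Qed.

Lemma urysohn_eq1 U x : open U -> U x -> \forall n \near \oo, urysohn U n x = 1.
Proof.
move=> oU Ux; have d0 : 0 < truncated_dist (~` U) x.
  by apply: truncated_dist_gt0; [exact: open_closedC|apply].
near=> n; rewrite /urysohn min_l// -ler_pdivrMr// mul1r.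
by near: n; exact: nbhs_infty_ger.
Unshelve. all: by end_near. Qed.

Lemma urysohn_cvg U x : open U -> urysohn U n x @[n --> \oo] --> (\1_U x : R).
Proof.
move=> oU; rewrite indicE; have [xU|xU] := boolP (x \in U).
  apply: cvg_near_cst; rewrite inE in xU.
  exact: urysohn_eq1.
rewrite (_ : (fun n => _) = fun=> 0); first exact: cvg_cst.
apply/funext => n; rewrite urysohn_out// => Ux.
by move: xU; rewrite mem_set.
Qed.

End urysohn_functions.

Section MH_separation.
Context {R : realType} {Y : completeMetricType R}.
Implicit Types (mu nu : borel_probability Y).

Lemma cvg_Rintegral_bounded mu (f_ : nat -> Y -> R) (f : Y -> R) :
  (forall n, bounded_lipschitz (f_ n)) ->
  measurable_fun [set: borel Y] (f : borel Y -> R) ->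
  (forall n x, `|f_ n x| <= 1) ->
  (forall x, f_ n x @[n --> \oo] --> f x) ->
  \int[mu]_(x in [set: borel Y]) f_ n x @[n --> \oo] -->
  \int[mu]_(x in [set: borel Y]) f x.
Proof.
move=> fB mf f1 cf.
have [|||||intf _ H] := @dominated_convergence _ (borel Y) R mu setT measurableT
  (fun n => EFin \o f_ n) (EFin \o f) (cst 1%E).
- by move=> n; apply/measurable_EFinP; exact: bl_measurable.
- exact/measurable_EFinP.
- apply: aeW => x _; apply: cvg_EFin; first by near=> n.
  exact: cf.
- exact: (bl_integrable mu (bl_cst 1)).
- by apply: aeW => x n _ /=; rewrite lee_fin.
apply: fine_cvg; rewrite fineK//; exact: integrable_fin_num.
Unshelve. all: by end_near. Qed.

(** Bounded Lipschitz functions see the measure of open sets: this is what makes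
[MH] separate measures. *)
Lemma open_measure_cvg mu (U : set Y) : open U ->
  \int[mu]_(x in [set: borel Y]) urysohn U n x @[n --> \oo] --> fine (mu U).
Proof.
move=> oU; have mU := open_borel oU.
rewrite (_ : fine (mu U) = \int[mu]_(x in [set: borel Y]) \1_U x).
  apply: cvg_Rintegral_bounded.
  - by move=> n; exact: urysohn_bl.
  - exact: measurable_indic.
  - by move=> n x; rewrite ger0_norm ?urysohn_ge0 ?urysohn_le1.
  - by move=> x; exact: urysohn_cvg.
by rewrite /Rintegral integral_indic// setIT.
Qed.

(** The scaled bound of [le_bl_MH] extends the equality of integrals from test
functions to Urysohn functions, hence to open sets, a pi-system generating the
Borel sets. *)
Lemma MH0_eq mu nu : MH mu nu = 0 -> eq_borel mu nu.
Proof.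
move=> E0.
have E (f : Y -> R) : bounded_lipschitz f ->
    \int[mu]_(x in [set: borel Y]) f x = \int[nu]_(x in [set: borel Y]) f x.
  move=> [K K0 [fL fK]].
  have K1 : 0 < K + 1 by rewrite ltr_pwDr.
  have := @le_bl_MH _ _ mu nu f (K + 1) K1; rewrite E0 mulr0 normr_le0 subr_eq0.
  move=> H; apply/eqP; apply: H => [x y|x].
    by rewrite (le_trans (fL x y))// ler_wpM2r ?mdist_ge0// lerDl.
  by rewrite (le_trans (fK x))// lerDl.
move=> A mA; apply: (@measure_unique _ R (borel Y) (@open Y) (fun=> setT)) => //.
- by move=> B C; exact: openI.
- by move=> _; exact: openT.
- by rewrite bigcup_const//; exists 0.
- move=> U oU; have mU := open_borel oU.
  rewrite -[LHS]fineK ?fin_num_measure// -[RHS]fineK ?fin_num_measure//.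
  congr EFin; have := open_measure_cvg (mu := mu) oU.
  under eq_fun => n do rewrite (E _ (urysohn_bl U n)).
  move=> /cvg_lim <- //; have /cvg_lim <- // := open_measure_cvg (mu := nu) oU.
- by move=> _; rewrite [X in (X < _)%E](probability_setT mu) ltry.
Qed.

End MH_separation.

Section density.
Context {R : realType} {Y : completeMetricType R}.
Implicit Types (mu nu : borel_probability Y).

Lemma closed_ball_far (x0 : Y) (r : R) : closed [set x : Y | mdist x0 x <= r].
Proof.
rewrite (_ : mkset _ = (mdist x0) @^-1` [set t | t <= r]) //.
apply: closed_comp => [x _|]; last exact: closed_le.
apply/cvgrPdist_lt => e e0; apply/nbhs_ballP; exists e => //= y.
rewrite ballEmdist/=; apply: le_lt_trans.
rewrite ler_norml lerNl opprB !lerBlDl; apply/andP; split.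
  exact: metric_triangle.
by rewrite addrC (metric_sym x y) addrC metric_triangle.
Qed.

(** The approximating measure is the image of [mu] under the map that fixes a
large closed ball and sends the rest of the space to its centre [x0]. *)
Lemma Mloc_dense : metric_dense (@MH R Y) (@Mloc R Y).
Proof.
move=> mu e e0; pose x0 : Y := point.
pose far n : set (borel Y) := ~` [set x : Y | mdist x0 x <= n%:R].
have mfar n : measurable (far n).
  by apply: measurableC; apply: closed_borel; exact: closed_ball_far.
have cap0 : \bigcap_n far n = set0.
  rewrite -subset0 => x /(_ (Num.truncn (mdist x0 x)).+1 Logic.I); apply.
  by apply/ltW; rewrite /= truncnS_gt.
have : mu (far n) @[n --> \oo] --> 0%E.
  rewrite -(measure0 mu) -cap0; apply: nonincreasing_cvg_mu => //.
  - by rewrite ltey_eq fin_num_measure.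
  - by rewrite cap0.
  - move=> m n mn; apply/subsetPset => x; apply: contra_not => /= xm.
    by rewrite (le_trans xm)// ler_nat.
move=> /fine_cvgP[_] /cvgrPdist_lt /(_ (e / 2)) /(_ _)[|n _ /(_ n (leqnn n))].
  exact: divr_gt0.
rewrite sub0r normrN /= ger0_norm ?fine_ge0// => farn.
pose g (x : borel Y) : borel Y := if mdist x0 x <= n%:R then x else x0.
have mg : measurable_fun setT g.
  apply: measurable_fun_ifT => //.
  apply: (@measurable_fun_bool _ _ _ _ true).
  rewrite setTI; rewrite (_ : _ @^-1` _ = ~` far n); first exact: measurableC.
  by rewrite setCK; apply/seteqP; split=> x /=.
pose G : {mfun borel Y >-> borel Y} :=
  MeasurableFun.Pack (MeasurableFun.Class (isMeasurableFun.Build _ _ _ _ g mg)).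
exists (distribution mu G).
- exists (n%:R + n%:R) => x y.
  have suppn z : supp (distribution mu G) z -> mdist x0 z <= n%:R.
    move=> zs; rewrite leNgt; apply/negP => zn; apply: zs.
    exists (far n); last by rewrite /far/=; apply/negP; rewrite -ltNge.
    split; first by apply: closed_openC; exact: closed_ball_far.
    rewrite /= /distribution /pushforward (_ : _ @^-1` _ = set0) ?measure0//.
    rewrite -subset0 => w; rewrite /far /preimage/= /g.
    by case: ifPn => // _; rewrite mdistxx.
  (* The support lies in the ball of radius n around x0, of diameter at most 2n. *)
  move=> /suppn xn /suppn yn; rewrite (le_trans (metric_triangle _ x0 _))//.
  by rewrite lerD// metric_sym.
- apply: (@le_lt_trans _ _ (2 * fine (mu (far n)))); last first.
    by rewrite -ltr_pdivlMl// mulrC.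
  apply: MH_le => f f1 fb; have fB := bl_lip1 f1 fb.
  have mfg : measurable_fun [set: borel Y] (f \o g).
    by apply: measurableT_comp => //; exact: bl_measurable.
  have ifg : mu.-integrable setT (EFin \o (f \o g)).
    apply: measurable_bounded_integrable => //.
      by rewrite [X in (X < _)%E](probability_setT mu) ltry.
    exists 1; split; first exact: num_real.
    by move=> M KM x _; exact: le_trans (fb (g x)) (ltW KM).
  have -> : \int[distribution mu G]_(x in [set: borel Y]) f x =
      \int[mu]_(x in [set: borel Y]) (f \o g) x.
    congr fine; rewrite integral_distribution//.
    by apply/measurable_EFinP; exact: bl_measurable.
  have iB := bl_integrable mu fB.
  rewrite -RintegralB//.
  have idf : mu.-integrable setT (EFin \o (fun x => f x - (f \o g) x)).
    by have := integrableB measurableT iB ifg.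
  rewrite (le_trans (le_normr_Rintegral _ _))//.
  rewrite -Rintegral_indic//.
  apply: le_Rintegral => //.
  + exact: (integrable_norm idf).
  + exact: indic_integrable.
  + move=> x _ /=; rewrite indicE /g.
    case: ifPn => xn.
      by rewrite subrr normr0 mulr_ge0.
    rewrite mem_set//=; last by apply/negP.
    rewrite mulr1 (le_trans (ler_normB _ _))//.
    by rewrite (_ : 2 = 1 + 1)// lerD.
Qed.

End density.

(** * Daniell extension from bounded Lipschitz functions *)

(** The enumeration is chosen before the family [a]: it must be the same for the
values [f_k x] at all points and for the values of the functional. *)
Lemma nneseries_pairing (R : realType) : exists p : nat -> nat * nat,
  forall a : nat -> nat -> \bar R, (forall i j, 0 <= a i j)%E ->
  (\sum_(n <oo) a (p n).1 (p n).2 = \sum_(i <oo) \sum_(j <oo) a i j)%E.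
Proof.
have /card_esym/ppcard_eqP[p] := card_nat2.
exists p => a a0.
have a0' i : (0 <= \sum_(j <oo) a i j)%E by exact: nneseries_ge0.
rewrite nneseries_esumT// [RHS]nneseries_esumT//.
under [RHS]eq_esum do rewrite nneseries_esumT//.
rewrite esum_esum// (_ : _ `*`` _ = setT); last by apply/seteqP; split.
by rewrite (reindex_esum [set: nat] setT p).
Qed.

Section daniell.
Context {R : realType} {Y : completeMetricType R}.
Implicit Types (f g : Y -> R) (A U : set Y).

Variable L : (Y -> R) -> R.
Hypothesis LD : forall f g, bounded_lipschitz f -> bounded_lipschitz g ->
  L (fun x => f x + g x) = L f + L g.
Hypothesis LZ : forall c f, bounded_lipschitz f -> L (fun x => c * f x) = c * L f.
Hypothesis L_ge0 : forall f, bounded_lipschitz f -> (forall x, 0 <= f x) ->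
  0 <= L f.
Hypothesis L1 : L (fun=> 1) = 1.
Hypothesis L_sigma : forall f_ : nat -> Y -> R,
  (forall k, bounded_lipschitz (f_ k)) -> (forall k x, 0 <= f_ k x) ->
  (forall x, 1 <= \sum_(k <oo) (f_ k x)%:E)%E ->
  (1 <= \sum_(k <oo) (L (f_ k))%:E)%E.

Lemma functional0 : L (fun=> 0) = 0.
Proof.
by have := LZ 0 (bl_cst 1); rewrite !mul0r.
Qed.

Lemma functionalB f g : bounded_lipschitz f -> bounded_lipschitz g ->
  L (fun x => f x - g x) = L f - L g.
Proof.
move=> fB gB; rewrite -mulN1r -LZ// -LD//.
  by congr L; apply/funext => x; rewrite mulN1r.
by apply: blM => //; exact: bl_cst.
Qed.

Lemma functional_sum (I : Type) (r : seq I) (f : I -> Y -> R) :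
  (forall i, bounded_lipschitz (f i)) ->
  L (fun x => \sum_(i <- r) f i x) = \sum_(i <- r) L (f i).
Proof.
move=> fB; elim: r => [|i r IH].
  by rewrite big_nil -[RHS]functional0; congr L; apply/funext => x; rewrite big_nil.
rewrite big_cons -IH -LD//; last exact: bl_sum.
by congr L; apply/funext => x; rewrite big_cons.
Qed.

Lemma functional_le f g : bounded_lipschitz f -> bounded_lipschitz g ->
  (forall x, f x <= g x) -> L f <= L g.
Proof.
move=> fB gB fg; rewrite -subr_ge0 -functionalB//; apply: L_ge0; first exact: blB.
by move=> x; rewrite subr_ge0.
Qed.

(** When [h] is the indicator of a set, these are the Daniell covers of the set. *)
Definition bl_cover (h : Y -> \bar R) (f_ : nat -> Y -> R) := [/\
  forall k, bounded_lipschitz (f_ k), forall k x, 0 <= f_ k x &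
  forall x, (h x <= \sum_(k <oo) (f_ k x)%:E)%E].

Definition upper_integral (h : Y -> \bar R) : \bar R :=
  ereal_inf [set (\sum_(k <oo) (L (f_ k))%:E)%E | f_ in bl_cover h].

Lemma upper_integral_ge0 h : (0 <= upper_integral h)%E.
Proof.
apply: le_ereal_inf_tmp => _ [f_ [fB f0 _] <-].
by apply: nneseries_ge0 => k _ _; rewrite lee_fin L_ge0.
Qed.

Lemma le_upper_integral h h' : (forall x, (h x <= h' x)%E) ->
  (upper_integral h <= upper_integral h')%E.
Proof.
move=> hh'; apply: ereal_inf_le_tmp => _ [f_ [fB f0 hf] <-].
by exists f_ => //; split => // x; exact: le_trans (hh' x) (hf x).
Qed.

Lemma upper_integral_le h (f_ : nat -> Y -> R) : bl_cover h f_ ->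
  (upper_integral h <= \sum_(k <oo) (L (f_ k))%:E)%E.
Proof. by move=> hf; apply: ereal_inf_lbound; exists f_. Qed.

Lemma upper_integral_le_L h f : bounded_lipschitz f -> (forall x, 0 <= f x) ->
  (forall x, (h x <= (f x)%:E)%E) -> (upper_integral h <= (L f)%:E)%E.
Proof.
move=> fB f0 hf; pose f_ k := if k is 0%N then f else fun=> 0.
have H (v : (Y -> R) -> R) : v (fun=> 0) = 0 -> 0 <= v f ->
    (\sum_(k <oo) (v (f_ k))%:E = (v f)%:E)%E.
  move=> v0 vf; rewrite nneseries_recl//; last first.
    by move=> [|k] _ /=; rewrite lee_fin ?v0.
  rewrite eseries_cond/= eseries0 ?adde0// => -[|k]//= _ _.
  by rewrite v0.
rewrite -(H L) ?functional0//; last exact: L_ge0.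
apply: upper_integral_le; split.
- by move=> [|k] /=; [exact: fB|exact: bl_cst].
- by case.
- by move=> x; rewrite (H (fun g => g x)).
Qed.

(** Choosing for the [i]-th term a cover that is optimal up to [e / 2^(i+1)] and
merging all of them into one sequence gives a cover of the sum. Stated for
functions rather than for sets because the Caratheodory argument needs it for
the pieces of a cover. *)
Lemma upper_integral_sum (h : Y -> \bar R) (h_ : nat -> Y -> \bar R) :
  (forall i x, 0 <= h_ i x)%E -> (forall x, h x <= \sum_(i <oo) h_ i x)%E ->
  (upper_integral h <= \sum_(i <oo) upper_integral (h_ i))%E.
Proof.
move=> h0 hh; have u0 := upper_integral_ge0.
have [[i ioo]|] := pselect (exists i, upper_integral (h_ i) = +oo%E).
  by rewrite (nneseries_pinfty _ _ ioo) ?leey.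
rewrite -forallNE => Aoo.
apply/lee_addgt0Pr => e e0.
rewrite (le_trans _ (epsilon_trick _ _ (ltW e0)))//.
have /choice[G PG] i : exists f_ : nat -> Y -> R, bl_cover (h_ i) f_ /\
    (\sum_(k <oo) (L (f_ k))%:E <= upper_integral (h_ i) +
      (e / (2 ^ i.+1)%:R)%:E)%E.
  have fin : upper_integral (h_ i) \is a fin_num.
    by rewrite ge0_fin_numE// ltey; apply/eqP; exact: Aoo.
  have ei : 0 < e / (2 ^ i.+1)%:R by rewrite divr_gt0// ltr0n expn_gt0.
  have [_ [f_ fc <-] lt] := lb_ereal_inf_adherent ei fin.
  by exists f_; split => //; exact: ltW.
have [p pP] := nneseries_pairing R.
have GL0 i j : (0 <= (L (G i j))%:E)%E.
  by rewrite lee_fin; have [[GB G0 _] _] := PG i; exact: L_ge0.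
apply: (@le_trans _ _ (\sum_(i <oo) \sum_(j <oo) (L (G i j))%:E)%E); last first.
  apply: lee_nneseries => i _; first by move=> _; exact: nneseries_ge0.
  exact: (PG i).2.
rewrite -(pP (fun i j => (L (G i j))%:E))//.
apply: (@upper_integral_le h (fun n => G (p n).1 (p n).2)); split.
- by move=> n; have [[GB _ _] _] := PG (p n).1.
- by move=> n x; have [[_ G0 _] _] := PG (p n).1.
- move=> x; rewrite (pP (fun i j => (G i j x)%:E)); last first.
    by move=> i j; have [[_ G0 _] _] := PG i; rewrite lee_fin.
  apply: le_trans (hh x) _; apply: lee_nneseries => // i _.
  by have [[_ _ ->] _] := PG i.
Qed.


Definition bl_outer (A : set Y) : \bar R :=
  upper_integral (fun x => (\1_A x)%:E).

Let bl_outer_le A f : bounded_lipschitz f -> (forall x, 0 <= f x) ->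
  (forall x, A x -> 1 <= f x) -> (bl_outer A <= (L f)%:E)%E.
Proof.
move=> fB f0 Af; apply: upper_integral_le_L => // x.
rewrite indicE lee_fin; have [xA|xA] /= := boolP (x \in A); last exact: f0.
by apply: Af; rewrite inE in xA.
Qed.

Let bl_outer0 : bl_outer set0 = 0%E.
Proof.
apply/eqP; rewrite eq_le upper_integral_ge0 andbT.
by rewrite -[leRHS]/((0 : R)%:E) -functional0; apply: bl_outer_le => //; exact: bl_cst.
Qed.

Let bl_outer_ge0 A : (0 <= bl_outer A)%E.
Proof. exact: upper_integral_ge0. Qed.

Let le_bl_outer : {homo bl_outer : A B / A `<=` B >-> (A <= B)%E}.
Proof.
move=> A B AB; apply: le_upper_integral => x; rewrite lee_fin !indicE.
have [xA|xA] /= := boolP (x \in A); last by case: (_ \in _).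
by rewrite mem_set//; apply: AB; rewrite inE in xA.
Qed.

Let bl_outer_sigma_subadditive : sigma_subadditive bl_outer.
Proof.
move=> F; apply: upper_integral_sum => [i x|x].
  by rewrite lee_fin.
rewrite indicE; have [|_] /= := boolP (x \in _); last exact: nneseries_ge0.
rewrite inE => -[i _ Fix_].
by rewrite (@nneseriesD1 _ _ i)// indicE mem_set//= leeDl// nneseries_ge0.
Qed.

HB.instance Definition _ := isOuterMeasure.Build R Y bl_outer
  bl_outer0 bl_outer_ge0 le_bl_outer bl_outer_sigma_subadditive.

(** Let [g n] be the Urysohn functions of [U]. A cover [f_k] of [X] splits as
[f_k = sum_(i < n) f_k (g (i+1) - g i) + f_k (1 - g n)]. On [X `&` U] the first
parts, for all [i], still add up to at least 1, and off [U] the remainder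
[f_k (1 - g n)] is all of [f_k]. As the functional is additive, the two outer
measures together cost no more than the original cover. *)
Lemma open_bl_outer_caratheodory U : open U ->
  caratheodory_measurable bl_outer U.
Proof.
move=> oU; apply: le_caratheodory_measurable => X.
apply: le_ereal_inf_tmp => _ [f_ [fB f0 Xf] <-].
pose g := urysohn U.
have gB n : bounded_lipschitz (g n) by exact: urysohn_bl.
pose d k i x := f_ k x * (g i.+1 x - g i x).
have dB k i : bounded_lipschitz (d k i) by apply: blM => //; exact: blB.
have d0 k i x : 0 <= d k i x.
  by rewrite mulr_ge0// subr_ge0 urysohn_nondecreasing.
pose r k i x := f_ k x * (1 - g i x).
have rB k i : bounded_lipschitz (r k i).
  by apply: blM => //; apply: blB => //; exact: bl_cst.
have r0 k i x : 0 <= r k i x by rewrite mulr_ge0// subr_ge0 urysohn_le1.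
have sum_d k n x : \sum_(0 <= i < n) d k i x = f_ k x * g n x.
  by rewrite -mulr_sumr telescope_sumr// /g urysohn0 subr0.
have Ld0 k i : (0 <= (L (d k i))%:E)%E by rewrite lee_fin L_ge0.
(* At a point of U the telescoping sum reaches 1 after finitely many steps. *)
have in_U : (bl_outer (X `&` U) <=
    \sum_(i <oo) \sum_(k <oo) (L (d k i))%:E)%E.
  apply: (@le_trans _ _ (\sum_(i <oo)
      upper_integral (fun x => \sum_(k <oo) (d k i x)%:E)%E)%E).
    apply: upper_integral_sum => [i x|x].
      by apply: nneseries_ge0 => k _ _; rewrite lee_fin.
    rewrite indicE; have [|_] /= := boolP (x \in _); last first.
      apply: nneseries_ge0 => i _ _.
      by apply: nneseries_ge0 => k _ _; rewrite lee_fin.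
    rewrite inE => -[Xx Ux].
    have [n _ /(_ n (leqnn n)) gn1] := urysohn_eq1 oU Ux.
    apply: (@le_trans _ _
        (\sum_(0 <= i < n) \sum_(k <oo) (d k i x)%:E)%E); last first.
      apply: nneseries_lim_ge => i _ _.
      by apply: nneseries_ge0 => k _ _; rewrite lee_fin.
    rewrite -nneseries_sum_nat; last by move=> i j; rewrite lee_fin.
    have := Xf x; rewrite indicE mem_set//= => /le_trans; apply.
    apply: lee_nneseries => [k _ _|k _]; first by rewrite lee_fin.
    by rewrite sumEFin sum_d /g gn1 mulr1.
  apply: lee_nneseries => i _; first by move=> _; exact: upper_integral_ge0.
  by apply: upper_integral_le; split.
have out_U n : (bl_outer (X `&` ~` U) +
    \sum_(0 <= i < n) \sum_(k <oo) (L (d k i))%:E <=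
    \sum_(k <oo) (L (f_ k))%:E)%E.
  rewrite -nneseries_sum_nat//.
  apply: (@le_trans _ _ (\sum_(k <oo) (L (r k n))%:E +
      \sum_(k <oo) \sum_(0 <= i < n) (L (d k i))%:E)%E).
    apply: leeD => //; apply: upper_integral_le; split => // x.
    rewrite indicE; have [|_] /= := boolP (x \in _); last first.
      by apply: nneseries_ge0 => k _ _; rewrite lee_fin.
    rewrite inE => -[Xx Ux].
    have := Xf x; rewrite indicE mem_set//= => /le_trans; apply.
    apply: lee_nneseries => [k _ _|k _]; first by rewrite lee_fin.
    by rewrite /r /g urysohn_out// subr0 mulr1.
  rewrite -nneseriesD; last 2 first.
  - by move=> k _ _; rewrite lee_fin L_ge0.
  - by move=> k _ _; apply: sume_ge0 => i _; exact: Ld0.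
  apply: lee_nneseries => [k _ _|k _].
    by apply: adde_ge0; [rewrite lee_fin L_ge0|apply: sume_ge0].
  rewrite sumEFin -EFinD lee_fin -functional_sum// -LD//; last exact: bl_sum.
  rewrite (_ : (fun x => _) = f_ k)//.
  by apply/funext => x; rewrite sum_d /r; ring.
(* It remains to let n tend to infinity in out_U. *)
rewrite addeC (le_trans (leeD2l _ in_U))//.
have [->|Sy] := eqVneq (\sum_(k <oo) (L (f_ k))%:E)%E +oo%E; first exact: leey.
have cfin : bl_outer (X `&` ~` U) \is a fin_num.
  rewrite ge0_fin_numE//; apply: (@le_lt_trans _ _ (\sum_(k <oo) (L (f_ k))%:E)%E).
    by have := out_U 0%N; rewrite big_geq// adde0.
  by rewrite ltey.
rewrite -leeBrDl//; apply: lime_le.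
  by apply: is_cvg_nneseries => i _ _; exact: nneseries_ge0.
by apply: nearW => n; rewrite leeBrDl.
Qed.


Let borel_caratheodory (A : set (borel Y)) : measurable A ->
  caratheodory_measurable bl_outer A.
Proof.
apply: smallest_sub A => [|U]; last exact: open_bl_outer_caratheodory.
split.
- exact: caratheodory_measurable_set0.
- by move=> A mA; rewrite setTD; exact: caratheodory_measurable_setC.
- by move=> F mF; exact: caratheodory_measurable_bigcup.
Qed.

Definition daniell_measure (A : set (borel Y)) : \bar R := bl_outer A.

Let daniell_measure0 : daniell_measure set0 = 0%E. Proof. exact: bl_outer0. Qed.

Let daniell_measure_ge0 A : (0 <= daniell_measure A)%E. Proof. exact: bl_outer_ge0. Qed.

Let daniell_measure_sigma_additive : semi_sigma_additive daniell_measure.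
Proof.
move=> F mF tF mUF; apply: (@caratheodory_measure_sigma_additive R Y bl_outer) => //.
- by move=> i; exact: borel_caratheodory.
- exact: borel_caratheodory.
Qed.

HB.instance Definition _ := isMeasure.Build _ _ _ daniell_measure
  daniell_measure0 daniell_measure_ge0 daniell_measure_sigma_additive.

(** The lower bound is the only place where a continuity property of [L] is
needed: without it the extension could lose mass. *)
Let daniell_measure_setT : daniell_measure setT = 1%E.
Proof.
apply/eqP; rewrite eq_le; apply/andP; split.
  by rewrite -[leRHS]/((1 : R)%:E) -L1; apply: bl_outer_le => //; exact: bl_cst.
apply: le_ereal_inf_tmp => _ [f_ [fB f0 Tf] <-]; apply: L_sigma => // x.
by have := Tf x; rewrite indicT.
Qed.

HB.instance Definition _ :=
  Measure_isProbability.Build _ _ _ daniell_measure daniell_measure_setT.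

Let P : borel_probability Y := daniell_measure.

(** A layer [f] of height [c] is integrated by the measure of the set where it is
positive, and [g / c] is a cover of that set by a single function. *)
Let integral_layer f g (c : R) : bounded_lipschitz f -> bounded_lipschitz g ->
  0 < c -> (forall x, 0 <= f x <= c) -> (forall x, 0 <= g x) ->
  (forall x, 0 < f x -> c <= g x) ->
  \int[P]_(x in [set: borel Y]) f x <= L g.
Proof.
move=> fB gB c0 fc g0 fg; pose A : set (borel Y) := [set x | 0 < f x].
have mA : measurable A.
  apply: open_borel; rewrite (_ : A = f @^-1` [set t | 0 < t])//.
  by apply: open_comp => [x _|]; [exact: bl_continuous|exact: open_gt].
apply: (@le_trans _ _ (c * fine (P A))).
  apply: Rintegral_le_measure => // x.
  have /andP[f0 fcx] := fc x.
  rewrite indicE; have [|xA] := boolP (x \in A); first by rewrite mulr1.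
  by rewrite mulr0 leNgt; apply: contra xA => ?; rewrite inE.
rewrite -ler_pdivlMl// -LZ// -lee_fin fineK ?fin_num_measure//.
apply: bl_outer_le => [|x|x Ax].
- by apply: blM => //; exact: bl_cst.
- by rewrite mulr_ge0// invr_ge0 ltW.
- by rewrite ler_pdivlMl// mulr1 fg.
Qed.

(** Cut [f] into [n + 1] horizontal layers [h i] of height [c]. Where the layer
[h (i+1)] is positive the layer below it is full, so its integral is at most
[L (h i)]; only the bottom layer is left over, and it contributes at most [c]. *)
Let integral_le_L f : bounded_lipschitz f -> (forall x, 0 <= f x <= 1) ->
  \int[P]_(x in [set: borel Y]) f x <= L f.
Proof.
move=> fB f01; apply/ler_addgt0Pr => e e0.
pose n := Num.truncn e^-1; pose c : R := n.+1%:R^-1.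
have c0 : 0 < c by rewrite invr_gt0.
have ce : c <= e.
  by rewrite -[leRHS]invrK lef_pV2 ?posrE ?invr_gt0//; apply/ltW/truncnS_gt.
pose t i x := Num.min (f x) (i%:R * c).
pose h i x := t i.+1 x - t i x.
have tB i : bounded_lipschitz (t i) by apply: bl_min => //; exact: bl_cst.
have hB i : bounded_lipschitz (h i) by exact: blB.
have icS i : i.+1%:R * c = i%:R * c + c by rewrite -natr1 mulrDl mul1r.
have h0 i x : 0 <= h i x <= c.
  rewrite /h /t icS; have := f01 x; move: (i%:R * c) (f x) => a b.
  by rewrite /Num.min; do 2 case: ifPn; rewrite -?leNgt; lra.
have sum_h x : f x = \sum_(0 <= i < n.+1) h i x.
  rewrite telescope_sumr// /t mul0r divff// min_l; last by case/andP: (f01 x).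
  by rewrite min_r ?subr0//; case/andP: (f01 x).
have intL i : \int[P]_(x in [set: borel Y]) h i.+1 x <= L (h i).
  apply: (@integral_layer _ _ c) => // [x|x]; first by case/andP: (h0 i x).
  rewrite /h /t !icS; move: (i%:R * c) (f x) => a b.
  by rewrite /Num.min; do 3 case: ifPn; rewrite -?leNgt; lra.
have -> : \int[P]_(x in [set: borel Y]) f x =
    \sum_(0 <= i < n.+1) \int[P]_(x in [set: borel Y]) h i x.
  under [LHS]eq_Rintegral do rewrite sum_h.
  elim: n.+1 => [|m IH].
    rewrite big_nil; under eq_Rintegral do rewrite big_nil.
    exact: Rintegral_cst1.
  rewrite big_nat_recr//= -IH -RintegralD//; try exact: bl_integrable.
    by apply: eq_Rintegral => x _; rewrite big_nat_recr.
  by apply: bl_integrable; exact: bl_sum.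
rewrite big_nat_recl// addrC lerD//; last first.
  apply: le_trans ce; rewrite -(Rintegral_cst1 P c).
  apply: le_Rintegral => //; try exact: bl_integrable.
    exact: (bl_integrable P (bl_cst c)).
  by move=> x _; case/andP: (h0 0%N x).
apply: le_trans (ler_sum _ _) _; first by move=> i _; exact: intL.
rewrite -functional_sum//; apply: functional_le => // [|x]; first exact: bl_sum.
rewrite sum_h big_nat_recr//= lerDl.
by case/andP: (h0 n x).
Qed.

(** The bound [integral_le_L] applied to [f] and to [1 - f] gives equality for
functions with values in [0, 1], since both sides take the value 1 at 1; an
affine change of variable covers the general case. *)
Theorem daniell_representation : exists mu : borel_probability Y,
  forall f, bounded_lipschitz f -> \int[mu]_(x in [set: borel Y]) f x = L f.
Proof.
exists P => f fB.
have [K K0 [_ fK]] := fB.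
have K1 : 0 < K + 1 by rewrite ltr_pwDr.
pose c := (K + 1) * 2; have c0 : 0 < c by rewrite mulr_gt0.
pose g x := c^-1 * (f x + (K + 1)).
have gB : bounded_lipschitz g.
  by apply: blM; [exact: bl_cst|apply: blD => //; exact: bl_cst].
have g01 x : 0 <= g x <= 1.
  have := fK x; rewrite ler_norml => /andP[fl fr].
  apply/andP; split; first by rewrite mulr_ge0 ?invr_ge0 ?ltW//; lra.
  by rewrite ler_pdivrMl// mulr1 /c; lra.
have intE1 : \int[P]_(x in [set: borel Y]) g x = L g.
  apply/eqP; rewrite eq_le integral_le_L//=.
  have cB := @bl_cst R Y 1.
  have := @integral_le_L (fun x => 1 - g x) (blB cB gB).
  rewrite functionalB// L1 RintegralB//; try exact: bl_integrable.
  rewrite Rintegral_cst1 lerD2l lerN2; apply => x.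
  by have := g01 x; lra.
have fE : f = fun x => c * g x - (K + 1).
  by apply/funext => x; rewrite /g mulrA divff ?gt_eqF// mul1r addrK.
have cgB : bounded_lipschitz (fun x => c * g x).
  by apply: blM => //; exact: bl_cst.
have kB : bounded_lipschitz (fun _ : Y => K + 1) by exact: bl_cst.
have LK : L (fun=> K + 1) = K + 1.
  by have := LZ (K + 1) (bl_cst 1); rewrite L1 !mulr1.
rewrite fE functionalB// LZ// LK RintegralB//; try exact: bl_integrable.
by rewrite RintegralZl//; [rewrite intE1 Rintegral_cst1|exact: bl_integrable].
Qed.

End daniell.

(** * Tightness and limits of Cauchy sequences *)

Section total_boundedness.
Context {R : realType} {Y : completeMetricType R}.

(** An ultrafilter containing [K] contains one of the finitely many balls of
radius [e] for every [e], so it is Cauchy and converges by completeness. *)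
Lemma closed_totally_bounded_compact (K : set Y) : closed K ->
  (forall e : R, 0 < e -> exists (n : nat) (c : nat -> Y),
    K `<=` [set x | exists2 j, (j < n)%N & mdist (c j) x < e]) ->
  compact K.
Proof.
move=> cK tK; rewrite compact_ultra => F FU FK.
have cF : cvg F.
  apply: cauchy_cvg; apply: cauchy_exP => e e0.
  have [n [c Kc]] := tK e e0.
  apply: contrapT => /forallNP NF.
  have /filter_ex[x [Kx nx]] : F (K `&` [set x | forall j : 'I_n, ~ ball (c j) e x]).
    apply: filterI => //; apply: filter_forall => j.
    by have [/NF|//] := in_ultra_setVsetC (ball (c j) e) FU.
  have [j jn cjx] := Kc _ Kx.
  by apply: (nx (Ordinal jn)); rewrite ballEmdist.
exists (lim F); split => //.
by apply: cK => B /cF FB; apply: (@filter_ex _ F); exact: filterI.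
Qed.

End total_boundedness.

Section dense_sequence.
Context {R : realType} {Y : completeMetricType R}.

Lemma separable_sequence : separable Y ->
  exists c : nat -> Y, forall x (e : R), 0 < e -> exists j, mdist x (c j) < e.
Proof.
move=> [D /countable_injP[f finj] dD].
exists (fun n => xget point [set y | D y /\ f y = n]) => x e e0.
have [|y [xy Dy]] := dD (ball x e)^° _ (open_interior _).
  by exists x; exact: nbhsx_ballx.
exists (f y); case: xgetP => [z _ [Dz fzy]|/(_ y)]; last by case.
have <- : y = z by apply: finj; rewrite ?inE.
by have := interior_subset xy; rewrite ballEmdist.
Qed.

(** The distance to the finite set [c 0, ..., c (n-1)], truncated at 1: both
the truncation and the 1-Lipschitz bound make it a test function of [MH]. *)
Fixpoint dist_initial (c : nat -> Y) (n : nat) (x : Y) : R :=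
  if n is m.+1 then Num.min (dist_initial c m x) (mdist x (c m)) else 1.

Variable c : nat -> Y.
Local Notation d := (dist_initial c).

Lemma dist_initial_ge0 n x : 0 <= d n x.
Proof. by elim: n => [|n IH] //=; rewrite le_min IH mdist_ge0. Qed.

Lemma dist_initial_nonincreasing x : nonincreasing_seq (d ^~ x).
Proof. by apply/nonincreasing_seqP => n /=; rewrite ge_min lexx. Qed.

Lemma dist_initial_le1 n x : d n x <= 1.
Proof. exact: (@dist_initial_nonincreasing x 0%N n). Qed.

Lemma dist_initial_norm_le1 n x : `|d n x| <= 1.
Proof. by rewrite ger0_norm ?dist_initial_ge0// dist_initial_le1. Qed.

Lemma dist_initial_lip1 n : Lip1 (d n).
Proof.
have H x y : d n x - d n y <= mdist x y.
  elim: n => [|n]/=; first by rewrite subrr mdist_ge0.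
  have := metric_triangle x y (c n); move: (d n x) (d n y) (mdist x y) => a b e.
  by rewrite /Num.min; do 2 case: ifPn; rewrite -?leNgt; lra.
move=> x y; rewrite ler_norml H andbT lerNl opprB.
by rewrite (le_trans (H y x))// metric_sym.
Qed.

Lemma dist_initial_bl n : bounded_lipschitz (d n).
Proof. by apply: bl_lip1; [exact: dist_initial_lip1|exact: dist_initial_norm_le1]. Qed.

Lemma dist_initial_lt n x (e : R) : e <= 1 -> d n x < e ->
  exists2 j, (j < n)%N & mdist x (c j) < e.
Proof.
move=> e1; elim: n => [|n IH]/=; first by rewrite ltNge e1.
rewrite gt_min => /orP[/IH[j jn xj]|xn]; last by exists n.
by exists j => //; exact: ltnW.
Qed.

Hypothesis c_dense : forall x (e : R), 0 < e -> exists j, mdist x (c j) < e.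

Lemma dist_initial_cvg0 x : d n x @[n --> \oo] --> (0 : R).
Proof.
apply/cvgrPdist_lt => e e0; have [j xj] := c_dense x e0.
exists j.+1 => // n /= jn; rewrite sub0r normrN ger0_norm ?dist_initial_ge0//.
apply: le_lt_trans (dist_initial_nonincreasing x jn) _ => /=.
by rewrite gt_min xj orbT.
Qed.

End dense_sequence.

Section cauchy_sequence.
Context {R : realType} {Y : completeMetricType R}.
Variable u : nat -> borel_probability Y.
Hypothesis u_cauchy : forall e : R, 0 < e ->
  exists N, forall m n, (N <= m)%N -> (N <= n)%N -> MH (u m) (u n) < e.
Implicit Types f g : Y -> R.

Local Notation E n f := (\int[u n]_(x in [set: borel Y]) f x).

(** Bounded convergence gives a [J] for each measure separately. Beyond the rank
[N] given by the Cauchy condition all integrals of a test function are within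
[e / 2] of the one for [u N], so a [J] that serves the first [N + 1] measures
serves all of them. *)
Lemma uniform_dist_initial (c : nat -> Y) :
  (forall x (e : R), 0 < e -> exists j, mdist x (c j) < e) ->
  forall e : R, 0 < e -> exists J, forall n, E n (dist_initial c J) <= e.
Proof.
move=> c_dense e e0; have e20 : 0 < e / 2 by exact: divr_gt0.
have [N HN] := u_cauchy e20.
have /choice[J HJ] i : exists J, forall m, (J <= m)%N ->
    E i (dist_initial c m) <= e / 2.
  have := @cvg_Rintegral_bounded _ _ (u i) (dist_initial c) (fun=> 0) _ _ _ _.
  rewrite Rintegral_cst1 => H.
  have /cvgrPdist_lt /(_ _ e20)[J _ HJ] := H (dist_initial_bl c)
    (@measurable_cst _ _ _ _ _ _) (dist_initial_norm_le1 c)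
    (dist_initial_cvg0 c_dense).
  exists J => m /HJ /=; rewrite sub0r normrN => /ltW; apply: le_trans.
  exact: ler_norm.
pose M := (\max_(i < N.+1) J i)%N; exists M => n.
have smallM i : (i <= N)%N -> E i (dist_initial c M) <= e / 2.
  rewrite -ltnS => iN; apply: HJ.
  exact: (@leq_bigmax 'I_N.+1 (fun i => J i) (Ordinal iN)).
have [nN|Nn] := leqP n N; first by rewrite (le_trans (smallM n nN))//; lra.
have H1 := smallM N (leqnn N).
have H2 := HN n N (ltnW Nn) (leqnn N).
have := @le_MH _ _ (u n) (u N) (dist_initial c M) (@dist_initial_lip1 _ _ c M)
  (dist_initial_norm_le1 c M).
move=> /(le_trans (ler_norm _)) H3; lra.
Qed.

(** By Markov's inequality and [uniform_dist_initial], for each [k] all the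
measures give mass at most [e / 2^(k+1)] to the points at distance more than
[1 / (k+2)] from some finite set. Removing these open sets for all [k] leaves a
closed, totally bounded set. *)
Lemma cauchy_tight : separable Y -> forall e : R, 0 < e ->
  exists2 K : set Y, compact K & closed K /\ forall n, (u n (~` K) <= e%:E)%E.
Proof.
move=> /separable_sequence[c c_dense] e e0.
(* Radii below 1, the level at which dist_initial is truncated. *)
pose dl k : R := k.+2%:R^-1.
have dl0 k : 0 < dl k by rewrite invr_gt0.
have dl1 k : dl k < 1 by rewrite invf_lt1// ltr1n.
pose ek k : R := e / (2 ^ k.+1)%:R.
have ek0 k : 0 < ek k by rewrite divr_gt0// ltr0n expn_gt0.
have /choice[J HJ] k := uniform_dist_initial c_dense (mulr_gt0 (dl0 k) (ek0 k)).
pose far k : set Y := [set x | dl k < dist_initial c (J k) x].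
have ofar k : open (far k).
  rewrite (_ : far k = dist_initial c (J k) @^-1` [set t | dl k < t])//.
  apply: open_comp => [x _|]; last exact: open_gt.
  by apply: bl_continuous; exact: dist_initial_bl.
have mfar k := open_borel (ofar k).
pose K := ~` \bigcup_k far k.
have oK : open (\bigcup_k far k) by exact: bigcup_open.
have cK : closed K by exact: open_closedC.
exists K; last split => // n.
  apply: closed_totally_bounded_compact => // r r0.
  pose k := Num.truncn r^-1; exists (J k), c => x Kx /=.
  have kr : dl k < r.
    rewrite -[ltRHS]invrK ltf_pV2 ?posrE ?invr_gt0//.
    by rewrite (lt_trans (truncnS_gt _))// ltr_nat.
  have xk : dist_initial c (J k) x <= dl k.
    by rewrite leNgt; apply/negP => xk; apply: Kx; exists k.
  have [||j jk xj] := @dist_initial_lt _ _ c (J k) x (Num.min r 1).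
  - by rewrite ge_min lexx orbT.
  - by rewrite (le_lt_trans xk)// lt_min kr dl1.
  exists j => //; rewrite metric_sym (lt_le_trans xj)//.
  by rewrite ge_min lexx.
rewrite setCK.
apply: (@le_trans _ _ (\sum_(k <oo) u n (far k))%E).
  by apply: measure_sigma_subadditive => //; exact: open_borel oK.
apply: le_trans (epsilon_trick0 xpredT (ltW e0)).
apply: lee_nneseries => // k _.
rewrite -[leLHS]fineK ?fin_num_measure// lee_fin -/(ek k).
rewrite -(ler_pM2l (dl0 k)); apply: le_trans (HJ k n).
apply: measure_le_Rintegral => //; first exact: dist_initial_bl.
move=> x; rewrite indicE; have [|_] := boolP (x \in far k).
  by rewrite inE mulr1 => /ltW.
by rewrite mulr0 dist_initial_ge0.
Qed.

Definition cauchy_lim f : R := lim (E n f @[n --> \oo]).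
Local Notation L := cauchy_lim.

Lemma cauchy_lim_cvg f : bounded_lipschitz f -> E n f @[n --> \oo] --> L f.
Proof.
move=> [K K0 [fL fK]].
have K1 : 0 < K + 1 by rewrite ltr_pwDr.
apply: cauchy_cvg; apply: cauchy_exP => e e0.
have [N HN] := u_cauchy (divr_gt0 e0 K1).
exists (E N f); exists N => // n /= Nn.
rewrite /ball/= (@le_lt_trans _ _ ((K + 1) * MH (u N) (u n)))//.
  apply: le_bl_MH => // [x y|x].
    by rewrite (le_trans (fL x y))// ler_wpM2r ?mdist_ge0// lerDl.
  by rewrite (le_trans (fK x))// lerDl.
by rewrite mulrC -ltr_pdivlMr// HN.
Qed.

Lemma cauchy_limD f g : bounded_lipschitz f -> bounded_lipschitz g ->
  L (fun x => f x + g x) = L f + L g.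
Proof.
move=> fB gB; apply: (cvg_lim (@Rhausdorff R)).
rewrite [X in X @ _](_ : _ = fun n => E n f + E n g).
  by apply: cvgD; exact: cauchy_lim_cvg.
by apply/funext => n; rewrite RintegralD//; exact: bl_integrable.
Qed.

Lemma cauchy_limZ a f : bounded_lipschitz f ->
  L (fun x => a * f x) = a * L f.
Proof.
move=> fB; apply: (cvg_lim (@Rhausdorff R)).
rewrite [X in X @ _](_ : _ = fun n => a * E n f).
  by apply: cvgM; [exact: cvg_cst|exact: cauchy_lim_cvg].
by apply/funext => n; rewrite RintegralZl//; exact: bl_integrable.
Qed.

Lemma cauchy_lim_ge f a : bounded_lipschitz f -> (forall n, a <= E n f) ->
  a <= L f.
Proof.
move=> fB fa; have fL := cauchy_lim_cvg fB.
rewrite -(cvg_lim (@Rhausdorff R) fL); apply: limr_ge; last exact: nearW.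
by apply/cvg_ex; exists (L f).
Qed.

Lemma cauchy_lim_ge0 f : bounded_lipschitz f -> (forall x, 0 <= f x) -> 0 <= L f.
Proof. by move=> fB f0; apply: cauchy_lim_ge => // n; exact: Rintegral_ge0. Qed.

Lemma cauchy_lim1 : L (fun=> 1) = 1.
Proof.
rewrite /L; under eq_fun do rewrite Rintegral_cst1.
exact: (cvg_lim (@Rhausdorff R) (cvg_cst _)).
Qed.

(** On a compact set [K] carrying mass at least [1 - e] for every [u n], a Dini
argument makes a single partial sum exceed [1 - e]; its integrals, and hence
its limit value, are then at least [(1 - e)^2]. *)
Lemma cauchy_lim_sigma (f_ : nat -> Y -> R) : separable Y ->
  (forall k, bounded_lipschitz (f_ k)) -> (forall k x, 0 <= f_ k x) ->
  (forall x, 1 <= \sum_(k <oo) (f_ k x)%:E)%E ->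
  (1 <= \sum_(k <oo) (L (f_ k))%:E)%E.
Proof.
move=> sepY fB f0 f1; apply/lee_addgt0Pr => r r0.
pose e := Num.min (r / 2) 1.
have e0 : 0 < e by rewrite lt_min divr_gt0//=.
have e1 : e <= 1 by rewrite ge_min lexx orbT.
have er : 2 * e <= r.
  by rewrite -ler_pdivlMl// mulrC ge_min lexx.
have [K cptK [cK uK]] := cauchy_tight sepY e0.
pose S m x := \sum_(0 <= k < m) f_ k x.
have SB m : bounded_lipschitz (S m) by exact: bl_sum.
have Smono m n x : (m <= n)%N -> S m x <= S n x.
  move=> mn; rewrite /S [leRHS](@big_cat_nat _ _ _ m)//= lerDl.
  by apply: sumr_ge0.
have [m _ /(_ m (leqnn m)) /= Sm] :
    \forall m \near \oo, K `<=` [set x | 1 - e < S m x].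
  have /compact_near_coveringP := cptK; apply => x Kx.
  have [m Smx] : exists m, 1 - e < S m x.
    apply: contrapT => /forallNP H; have := f1 x; apply/negP; rewrite -ltNge.
    apply: (@le_lt_trans _ _ (1 - e)%:E); last by rewrite lte_fin; lra.
    apply: lime_le; first by apply: is_cvg_nneseries => k _ _; rewrite lee_fin.
    apply: nearW => m; rewrite sumEFin lee_fin leNgt; apply/negP; exact: H.
  exists ([set y | 1 - e < S m y], [set n | (m <= n)%N]).
    split; last by exists m.
    apply: open_nbhs_nbhs; split => //.
    apply: (@open_comp _ _ (S m) [set t | 1 - e < t]) => [y _|]; last exact: open_gt.
    exact: bl_continuous.
  by move=> [y n] /= [Smy mn]; exact: lt_le_trans Smy (Smono _ _ _ mn).
have mK : measurable (K : set (borel Y)) by exact: closed_borel.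
have LS : (1 - e) * (1 - e) <= L (S m).
  apply: cauchy_lim_ge => // n.
  have uKn : 1 - e <= fine (u n K).
    have := uK n; rewrite probability_setC// -[u n K]fineK ?fin_num_measure//.
    by rewrite -EFinB lee_fin /=; lra.
  apply: (@le_trans _ _ ((1 - e) * fine (u n K))).
    by rewrite ler_wpM2l// subr_ge0.
  apply: measure_le_Rintegral => // x.
  rewrite indicE; have [|_] := boolP (x \in K).
    by rewrite inE mulr1 => /Sm/ltW.
  by rewrite mulr0 sumr_ge0.
have : ((L (S m))%:E <= \sum_(k <oo) (L (f_ k))%:E)%E.
  rewrite (functional_sum cauchy_limD cauchy_limZ)// -sumEFin.
  by apply: nneseries_lim_ge => k _ _; rewrite lee_fin cauchy_lim_ge0.
move=> H; apply: (@le_trans _ _ ((L (S m))%:E + r%:E)%E); last exact: leeD2r.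
by rewrite -EFinD lee_fin; nra.
Qed.

(** The Cauchy estimate bounds the difference of integrals uniformly over the test
functions, so it survives the passage to the limit in one of the two indices. *)
Lemma cauchy_MH_converges : separable Y ->
  exists mu, MH (u n) mu @[n --> \oo] --> (0 : R).
Proof.
move=> sepY.
have [mu muE] := daniell_representation cauchy_limD cauchy_limZ
  cauchy_lim_ge0 cauchy_lim1 (fun _ => cauchy_lim_sigma sepY).
exists mu; apply/cvgrPdist_le => e e0; have [N HN] := u_cauchy e0.
exists N => // n /= Nn; rewrite sub0r normrN ger0_norm ?MH_ge0//.
apply: MH_le => f f1 fb; have fB := bl_lip1 f1 fb; rewrite muE//.
have cf : `|E n f - E m f| @[m --> \oo] --> `|E n f - L f|.
  by apply: cvg_norm; apply: cvgB; [exact: cvg_cst|exact: cauchy_lim_cvg].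
rewrite -(cvg_lim (@Rhausdorff R) cf); apply: limr_le.
  by apply/cvg_ex; eexists; exact: cf.
exists N => // m /= Nm.
by rewrite (le_trans (le_MH _ _ f1 fb))// ltW// HN.
Qed.

End cauchy_sequence.

Theorem theorem2p12 (R : realType) (Y : completeMetricType R)
    (sepY : separable Y) :
  is_completion_of (@eq_borel R Y) (@MH R Y) (@Mloc R Y).
Proof.
split; last exact: Mloc_dense.
- split.
  + exact: MH_ge0.
  + by move=> mu nu; split; [exact: MH0_eq|exact: eq_MH0].
  + exact: MHC.
  + by move=> mu nu rho; exact: MH_triangle.
- move=> u uC; apply: cauchy_MH_converges => // e e0.
  have [[A B] /= [[N1 _ AN] [N2 _ BN]] AB] := uC e e0.
  exists (maxn N1 N2) => m n; rewrite !geq_max => /andP[m1 _] /andP[_ n2].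
  by apply: (AB (m, n)); split; [exact: AN|exact: BN].
Qed.
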